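(* Let $\mathbb{F}$ be a field of characteristic not two and $\eta\in\mathbb{F}\setminus\{\frac12,1\}$. Let $A$ be a $\mathcal{PC}(\eta)$-axial algebra over $\mathbb{F}$ generated by primitive axes $a$, $b$, and $c$. Then $A$ is the linear span of $a$, $b$, $c$, $ab$, $bc$, $ac$, $a(bc)$, $b(ac)$; in particular $\dim A\leq 8$. Furthermore, if $\alpha=\varphi_a(b)$, $\beta=\varphi_b(c)$, $\gamma=\varphi_c(a)$, and $\psi=\varphi_a(bc)$, then (i) $A_\eta(a)=\langle \alpha a+b-2ab,\ \gamma a+c-2ac,\ \psi a+bc-2a(bc)\rangle$; (ii) $A_{1/2}(a)=\langle \alpha(\eta-1)a-\eta b+ab,\ \gamma(\eta-1)a-\eta c+ac,\ \psi(\eta-1)a-\eta bc+a(bc),\ (2\eta^2-1)(2\psi-\beta)a-\eta\gamma b+(\eta-2\eta^2)\alpha c-bc+2b(ac)\rangle$.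
   Context: Algebras are not assumed associative or unital. For a commutative $\mathbb{F}$-algebra $A$, $a\in A$ and $\lambda\in\mathbb{F}$, put $A_\lambda(a)=\{u\in A\mid au=\lambda u\}$. A ($\mathcal{PC}(\eta)$-)axis in $A$ is an idempotent $a\in A$ such that $A=A_1(a)\oplus A_\eta(a)\oplus A_{1/2}(a)$ and the fusion law $\mathcal{PC}(\eta)$ holds: $A_1(a)A_1(a)\subseteq A_1(a)$, $A_1(a)A_\eta(a)\subseteq A_\eta(a)$, $A_1(a)A_{1/2}(a)\subseteq A_{1/2}(a)$, $A_\eta(a)A_\eta(a)\subseteq A_1(a)$, $A_\eta(a)A_{1/2}(a)\subseteq A_{1/2}(a)$, $A_{1/2}(a)A_{1/2}(a)\subseteq A_1(a)\oplus A_\eta(a)$. An axis $a$ is primitive if $A_1(a)=\langle a\rangle$ is $1$-dimensional. A $\mathcal{PC}(\eta)$-axial algebra is a commutative $\mathbb{F}$-algebra generated by a set of axes. For a primitive axis $x$ and $y\in A$, $\varphi_x(y)\in\mathbb{F}$ denotes the scalar such that the projection of $y$ on $A_1(x)$ (along $A_\eta(x)\oplus A_{1/2}(x)$) equals $\varphi_x(y)x$. $\langle\cdots\rangle$ denotes linear span. *)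

(* Defs.v *)
From mathcomp Require Import all_boot all_order all_algebra.
From mathcomp Require Import boolp classical_sets.

Set Implicit Arguments.
Unset Strict Implicit.
Unset Printing Implicit Defensive.

Import GRing.Theory.
Local Open Scope classical_set_scope.
Local Open Scope ring_scope.

Section LinearSets.
Variables (F : fieldType) (A : lmodType F).
Implicit Types (U V : set A) (s : seq A).

Definition lspan s : set A :=
  [set v | exists k : nat -> F, v = \sum_(i < size s) k i *: s`_i].

Definition addsp U V : set A := [set w | exists2 u, U u & exists2 v, V v & w = u + v].

Definition direct_sum3 U V W : Prop :=
  (forall y, exists u v w, [/\ U u, V v, W w & y = u + v + w]) /\
  (forall u v w, U u -> V v -> W w -> u + v + w = 0 ->
     [/\ u = 0, v = 0 & w = 0]).

(* [Vector.axiom n A] is the type of linear bijections from A to F^n. No finite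
   dimension is presupposed of A, which is only an F-module. *)
Definition dim_le (d : nat) : Prop :=
  exists2 n, (n <= d)%N & inhabited (Vector.axiom n A).

Definition is_subspace U : Prop :=
  U 0 /\ (forall (k : F) u v, U u -> U v -> U (k *: u + v)).

End LinearSets.
Arguments dim_le {F} A d.

(* A non-associative, non-unital F-algebra is an F-module A with a bilinear
   product [mul]; commutativity of [mul] is a separate hypothesis. *)
Section Axial.
Variables (F : fieldType) (eta : F) (A : lmodType F).
Variable mul : {bilinear A -> A -> A}.
Implicit Types (x y : A) (X U V W S : set A).

Definition is_subalgebra S : Prop :=
  is_subspace S /\ (forall u v, S u -> S v -> S (mul u v)).

Definition generates X : Prop :=
  forall S, is_subalgebra S -> X `<=` S -> S = [set: A].

Definition eigsp (lam : F) x : set A := [set u | mul x u = lam *: u].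

Definition prod_in U V W : Prop := forall u v, U u -> V v -> W (mul u v).

Definition fusion_law x : Prop :=
  [/\ prod_in (eigsp 1 x) (eigsp 1 x) (eigsp 1 x),
      prod_in (eigsp 1 x) (eigsp eta x) (eigsp eta x) &
      prod_in (eigsp 1 x) (eigsp 2^-1 x) (eigsp 2^-1 x)] /\
  [/\ prod_in (eigsp eta x) (eigsp eta x) (eigsp 1 x),
      prod_in (eigsp eta x) (eigsp 2^-1 x) (eigsp 2^-1 x) &
      prod_in (eigsp 2^-1 x) (eigsp 2^-1 x)
              (addsp (eigsp 1 x) (eigsp eta x))].

Definition axis x : Prop :=
  [/\ mul x x = x,
      direct_sum3 (eigsp 1 x) (eigsp eta x) (eigsp 2^-1 x) &
      fusion_law x].

(* [x != 0] says that the line <x> is 1-dimensional. *)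
Definition primitive_axis x : Prop :=
  [/\ axis x, x != 0 & eigsp 1 x = lspan [:: x]].

Definition axial_algebra : Prop :=
  commutative mul /\ exists2 X, (forall x, X x -> axis x) & generates X.

Definition proj_coef x y (k : F) : Prop :=
  exists2 u, eigsp eta x u & exists2 v, eigsp 2^-1 x v & y = k *: x + u + v.

(* [phi] is total: its value is the default 0 when no such scalar exists. For a
   primitive axis x the scalar exists and is unique, see [phiP], [phi_unique]. *)
Definition phi x y : F := xget 0 (proj_coef x y).

Lemma lspan1 x u : lspan [:: x] u -> exists k : F, u = k *: x.
Proof. by case=> k ->; exists (k 0%N); rewrite big_ord1. Qed.

Lemma phiP x y : primitive_axis x -> proj_coef x y (phi x y).
Proof.
case=> -[_ [dec _] _] _ e1.
have [u [v [w [Hu Hv Hw ->]]]] := dec y.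
apply: xgetPex; move: Hu; rewrite e1 => /lspan1[k ->].
by exists k; exists v => //; exists w.
Qed.

Lemma eigspB lam x u v : eigsp lam x u -> eigsp lam x v -> eigsp lam x (u - v).
Proof. by rewrite /eigsp /= linearBr => -> ->; rewrite scalerBr. Qed.

Lemma phi_unique x y k : primitive_axis x -> proj_coef x y k -> phi x y = k.
Proof.
move=> px [u Hu [v Hv e]]; have [u' Hu' [v' Hv' e']] := phiP y px.
case: px => -[_ [_ dir] _] x0 e1.
have Hx : eigsp 1 x ((phi x y - k) *: x).
  by rewrite e1; exists (fun=> phi x y - k); rewrite big_ord1.
have E : (phi x y - k) *: x + (u' - u) + (v' - v) = 0.
  by rewrite scalerBl [X in X + _]addrACA -opprD addrACA -opprD -e -e' subrr.
have [/eqP + _ _] := dir _ _ _ Hx (eigspB Hu' Hu) (eigspB Hv' Hv) E.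
by rewrite scaler_eq0 (negPf x0) orbF subr_eq0 => /eqP.
Qed.

End Axial.
Arguments phi {F} eta {A} mul x y.

(* Main.v *)
Require Import Defs.
From mathcomp Require Import all_boot all_order all_algebra.
From mathcomp Require Import boolp classical_sets.
From mathcomp Require Import ring.

(** For a primitive axis [a] write [y = P y a + y1 + y2], [z = P z a + z1 + z2]
    with eigenvector components, and let [e], [h] be the coefficients of [a] in
    [y1 z1] and [y2 z2]. Expanding in components gives the cyclic identity
    [a(yz) + y(az) + z(ay) =
      (1 + eta)(yz + P y az + P z ay) - eta(P y z + P z y) + T a],
    with [T] an explicit polynomial in [P y], [P z], [e], [h], and an explicit
    element [2 y(az) - yz + ...] of [A_{1/2}(a)]. The cyclic identity puts
    [c(ab)] in the span [S] of the eight products, and then shows that the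
    elements multiplying [S] into itself are stable under multiplication by
    [a], [b] and [c], so [S] is a subalgebra.

    The left side of the cyclic identity is symmetric in its three arguments,
    so comparing it for different axes constrains the scalars: either
    [eta = -1], [P] is symmetric on axes and [T = phi_b(c)], or all the
    projections of axes on one another and [psi] are 1 and [e = h = 0]. In both
    cases the coefficient of [a] in [2 b(ac) - bc + ...] is the stated one. *)

Set Implicit Arguments.
Unset Strict Implicit.
Unset Printing Implicit Defensive.

Import GRing.Theory.
Local Open Scope classical_set_scope.
Local Open Scope ring_scope.

(** * Equality of linear combinations *)

Section ModuleReflection.
Variables (F : fieldType) (A : lmodType F).

Inductive mexpr :=
  | MVar of nat | MZero | MAdd of mexpr & mexpr | MOpp of mexpr
  | MScale of F & mexpr.

Fixpoint meval (s : seq A) e : A :=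
  match e with
  | MVar n => s`_n
  | MZero => 0
  | MAdd e1 e2 => meval s e1 + meval s e2
  | MOpp e1 => - meval s e1
  | MScale k e1 => k *: meval s e1
  end.

(** The index test is [Nat.eqb] so that the [cbn] of [match_coefs] can evaluate it on numerals. *)
Fixpoint mcoef e (i : nat) : F :=
  match e with
  | MVar n => if Nat.eqb n i then 1 else 0
  | MZero => 0
  | MAdd e1 e2 => mcoef e1 i + mcoef e2 i
  | MOpp e1 => - mcoef e1 i
  | MScale k e1 => k * mcoef e1 i
  end.

Fixpoint same_coefs e1 e2 n : Prop :=
  if n is n'.+1 then mcoef e1 n' = mcoef e2 n' /\ same_coefs e1 e2 n' else True.

Lemma mevalE s e : meval s e = \sum_(i < size s) mcoef e i *: s`_i.
Proof.
elim: e => [n||e1 IH1 e2 IH2|e IH|k e IH] /=.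
- have [ns|sn] := ltnP n (size s).
    rewrite (bigD1 (Ordinal ns)) //= PeanoNat.Nat.eqb_refl scale1r.
    rewrite big1 ?addr0 // => i /eqP ne; case: PeanoNat.Nat.eqb_spec => [e|].
      by case: ne; apply: val_inj.
    by rewrite scale0r.
  rewrite nth_default // big1 // => i _; case: PeanoNat.Nat.eqb_spec => [e|].
    by move: sn; rewrite e leqNgt ltn_ord.
  by rewrite scale0r.
- by rewrite big1 // => i _; rewrite scale0r.
- by rewrite IH1 IH2 -big_split; apply: eq_bigr => i _; rewrite scalerDl.
- by rewrite IH -sumrN; apply: eq_bigr => i _; rewrite scaleNr.
- by rewrite IH scaler_sumr; apply: eq_bigr => i _; rewrite scalerA.
Qed.

(** The atoms in [s] need not be independent, so this criterion is sufficient only. *)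
Lemma meval_eq s e1 e2 : same_coefs e1 e2 (size s) -> meval s e1 = meval s e2.
Proof.
move=> H; rewrite !mevalE; apply: eq_bigr => i _; congr (_ *: _).
have: (i < size s)%N by [].
elim: (size s) (nat_of_ord i) H => // n IH j /= [H0 H1].
by rewrite ltnS leq_eqVlt => /orP[/eqP->|/IH]; last apply.
Qed.

End ModuleReflection.

Ltac atom_in x s :=
  lazymatch s with
  | nil => constr:(false)
  | cons x _ => constr:(true)
  | cons _ ?s' => atom_in x s'
  end.

Ltac atom_index x s :=
  lazymatch s with
  | cons x _ => constr:(0%N)
  | cons _ ?s' => let n := atom_index x s' in constr:(S n)
  end.

(** Any other term, in particular a product, is an atom; bilinearity has to be expanded
    beforehand. *)
Ltac atoms t s :=
  lazymatch t with
  | @GRing.add _ ?u ?v => let s := atoms u s in atoms v s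
  | @GRing.opp _ ?u => atoms u s
  | @GRing.scale _ _ _ ?u => atoms u s
  | @GRing.zero _ => s
  | ?x => lazymatch atom_in x s with true => s | false => constr:(cons x s) end
  end.

Ltac reify F t s :=
  lazymatch t with
  | @GRing.add _ ?u ?v =>
    let e1 := reify F u s in let e2 := reify F v s in constr:(MAdd e1 e2)
  | @GRing.opp _ ?u => let e := reify F u s in constr:(MOpp e)
  | @GRing.scale _ _ ?k ?u =>
    let e := reify F u s in constr:(@MScale F k e)
  | @GRing.zero _ => constr:(@MZero F)
  | ?x => let n := atom_index x s in constr:(@MVar F n)
  end.

(* Reduces an equality of linear combinations to one equality of coefficients
   per vector occurring in it; the field and the module are found in the
   context. *)
Ltac match_coefs :=
  match goal with
  | F : GRing.Field.type, A : GRing.Lmodule.type _ |- @eq _ ?u ?v =>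
    let s := atoms u (@nil (GRing.Lmodule.sort A)) in
    let s := atoms v s in
    let e1 := reify F u s in
    let e2 := reify F v s in
    apply: (@meval_eq F A s e1 e2);
    cbn [same_coefs mcoef Nat.eqb size]; repeat split
  end.

(** Turns a known identity into a linear relation; the second premise is a goal for
    [match_coefs]. *)
Lemma eq_sub0 (A : zmodType) (x y z : A) : x = y -> z = x - y -> z = 0.
Proof. by move=> -> ->; rewrite subrr. Qed.

(** * Spans and dimension *)

Section Spans.
Variables (F : fieldType) (A : lmodType F).
Implicit Types (s t : seq A) (S : set A).

Lemma subspaceZ S k u : is_subspace S -> S u -> S (k *: u).
Proof. by move=> [S0 SD] Su; rewrite -[_ *: _]addr0; exact: SD. Qed.

Lemma subspaceD S u v : is_subspace S -> S u -> S v -> S (u + v).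
Proof. by move=> [_ SD] Su Sv; rewrite -[u]scale1r; exact: SD. Qed.

Lemma subspaceN S u : is_subspace S -> S u -> S (- u).
Proof. by move=> HS Su; rewrite -scaleN1r; exact: subspaceZ. Qed.

Lemma lspan_subspace s : is_subspace (lspan s).
Proof.
split; first by exists (fun=> 0); rewrite big1 // => i _; rewrite scale0r.
move=> k _ _ [f ->] [g ->]; exists (fun i => k * f i + g i).
rewrite scaler_sumr -big_split; apply: eq_bigr => i _ /=.
by rewrite scalerA scalerDl.
Qed.

Lemma lspan_consP x s v :
  lspan (x :: s) v <-> exists k w, lspan s w /\ v = k *: x + w.
Proof.
split=> [[f ->]|[k [w [[f ->] ->]]]].
  exists (f 0%N), (\sum_(i < size s) f i.+1 *: s`_i).
  by split; [exists (f \o S) | rewrite big_ord_recl].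
by exists (fun i => if i is i'.+1 then f i' else k); rewrite big_ord_recl.
Qed.

Lemma lspan_nil_sub S : is_subspace S -> lspan [::] `<=` S.
Proof. by move=> [S0 _] v [f ->]; rewrite big_ord0. Qed.

Lemma lspan_cons_sub S x s :
  is_subspace S -> S x -> lspan s `<=` S -> lspan (x :: s) `<=` S.
Proof.
move=> HS Sx sS v /lspan_consP[k [w [sw ->]]].
by apply: subspaceD => //; [apply: subspaceZ | apply: sS].
Qed.

Lemma lspan_mem x s : x \in s -> lspan s x.
Proof.
elim: s => // y s IH; rewrite inE => /orP[/eqP <-|/IH xs]; apply/lspan_consP.
  exists 1, 0; rewrite scale1r addr0; split=> //.
  by case: (lspan_subspace s).
by exists 0, x; rewrite scale0r add0r.
Qed.

Definition independent s : Prop := forall k : nat -> F,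
  \sum_(i < size s) k i *: s`_i = 0 -> forall i, (i < size s)%N -> k i = 0.

(** The list is thinned from the right: a vector is kept exactly when it lies outside the span of
    those already kept. *)
Lemma exists_independent s :
  exists t, [/\ independent t, (size t <= size s)%N & lspan s `<=` lspan t].
Proof.
elim: s => [|x s [t [It le_ts st]]].
  by exists [::]; split=> // k _ i.
have [tx|tx] := pselect (lspan t x).
  exists t; split=> //; first exact: leqW.
  by apply: lspan_cons_sub => //; exact: lspan_subspace.
exists (x :: t); split=> //.
  move=> k; rewrite big_ord_recl /= => E.
  have k0 : k 0%N = 0.
    apply/eqP/contraT => k0; case: tx.
    have -> : x = - (k 0%N)^-1 *: \sum_(i < size t) k i.+1 *: t`_i.
      apply: (scalerI k0); move/eqP: E; rewrite addr_eq0 => /eqP ->.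
      by rewrite scalerA mulrN divff // scaleN1r.
    by apply: subspaceZ; [exact: lspan_subspace | exists (k \o S)].
  rewrite k0 scale0r add0r in E.
  by case=> // i; exact: (It (k \o S) E).
apply: lspan_cons_sub; first exact: lspan_subspace.
  by apply: lspan_mem; rewrite inE eqxx.
move=> v /st tv; apply/lspan_consP; exists 0, v.
by rewrite scale0r add0r.
Qed.

(** Coordinates in an independent spanning list are chosen by [cid]; their uniqueness makes the
    choice linear and bijective. *)
Lemma lspan_dim_le s : [set: A] = lspan s -> dim_le A (size s).
Proof.
move=> sT; have [t [It le_ts]] := exists_independent s; rewrite -sT => Tt.
exists (size t) => //.
have coordP v : {k : nat -> F | v = \sum_(i < size t) k i *: t`_i}.
  by apply: cid; exact: Tt.
pose coord v : 'rV[F]_(size t) := \row_i sval (coordP v) i.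
have coordK v : v = \sum_(i < size t) coord v 0 i *: t`_i.
  by rewrite {1}(svalP (coordP v)); apply: eq_bigr => i _; rewrite mxE.
have coord_uniq v (r : 'rV[F]_(size t)) :
    v = \sum_(i < size t) r 0 i *: t`_i -> coord v = r.
  move=> E; apply/rowP => j; apply/eqP; rewrite -subr_eq0; apply/eqP.
  (* Extended by 0 beyond [size t], since [independent] takes coefficients indexed by [nat]. *)
  pose k i := if insub i is Some i' then coord v 0 i' - r 0 i' else 0.
  have kE (i : 'I_(size t)) : k i = coord v 0 i - r 0 i.
    by rewrite /k valK.
  rewrite -kE; apply: It => //.
  under eq_bigr do rewrite kE scalerBl.
  by rewrite sumrB -coordK -E subrr.
constructor; exists coord.
  move=> k u v; apply: coord_uniq; rewrite {1}(coordK u) {1}(coordK v).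
  rewrite scaler_sumr -big_split; apply: eq_bigr => i _ /=.
  by rewrite !mxE scalerDl scalerA.
exists (fun r : 'rV[F]_(size t) => \sum_(i < size t) r 0 i *: t`_i) => [v|r].
  by rewrite -coordK.
exact: coord_uniq.
Qed.

End Spans.

(** * Primitive axes *)

Section PrimitiveAxes.
Variables (F : fieldType) (eta : F) (A : lmodType F).
Variable mul : {bilinear A -> A -> A}.
Hypothesis two_neq0 : 2 != 0 :> F.
Hypothesis eta_neq_half : eta != 2^-1.
Hypothesis eta_neq1 : eta != 1.
Hypothesis mulC : commutative mul.
Local Notation "x ** y" := (mul x y) (at level 39, left associativity).
Local Notation P := (phi eta mul).
Local Notation axisp := (primitive_axis eta mul).

Let half_neq : 1 - 2 * eta != 0.
Proof.
apply: contraNneq eta_neq_half => e; apply/eqP.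
by apply: (mulfI two_neq0); rewrite divff //; apply/eqP; rewrite eq_sym -subr_eq0 e.
Qed.

Let mulDl x y z : (x + y) ** z = x ** z + y ** z. Proof. exact: linearDl. Qed.
Let mulDr x y z : x ** (y + z) = x ** y + x ** z. Proof. exact: linearDr. Qed.
Let mulNl x y : (- x) ** y = - (x ** y). Proof. exact: linearNl. Qed.
Let mulNr x y : x ** (- y) = - (x ** y). Proof. exact: linearNr. Qed.
Let mulZl k x y : (k *: x) ** y = k *: (x ** y). Proof. exact: linearZl. Qed.
Let mulZr k x y : x ** (k *: y) = k *: (x ** y). Proof. exact: linearZr. Qed.
Let mulE := (mulDl, mulDr, mulNl, mulNr, mulZl, mulZr).

(* [e] and [h] are the coefficients of [a] in the product of the eta-parts and
   in the product of the 1/2-parts of [y] and [z]. *)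
Lemma axis_products a y z : axisp a -> exists e h : F,
  [/\ P a (y ** z) = P a y * P a z + e + h,
      a ** (y ** z) + y ** (a ** z) + z ** (a ** y) =
        (1 + eta) *: (y ** z + P a y *: a ** z + P a z *: a ** y)
        - eta *: (P a y *: z + P a z *: y)
        + (- eta * P a y * P a z + eta * e + (1 - eta) * h) *: a,
      eigsp mul 2^-1 a
        (2 *: y ** (a ** z) - y ** z - (eta * P a z) *: y
         - ((2 * eta ^+ 2 - eta) * P a y) *: z
         + ((2 * eta ^+ 2 - 1) * P a y * P a z - (2 * eta - 1) * e) *: a) &
      (P a y *: a + y - 2 *: a ** y) ** (P a z *: a + z - 2 *: a ** z) =
        ((1 - 2 * eta) ^+ 2 * e) *: a].
Proof.
move=> pa; have [u1 Hu1 [u2 Hu2 ey]] := phiP y pa.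
have [v1 Hv1 [v2 Hv2 ez]] := phiP z pa.
have [[aa dir [_ [f11 f12 f22]]] _ e1] := pa.
(* Fusion and primitivity give [u1 ** v1 = e *: a] and [u2 ** v2 = h *: a + k] with [k] in the
   eta-eigenspace; the mixed products are 1/2-eigenvectors. *)
move: (f11 _ _ Hu1 Hv1); rewrite e1 => /lspan1[e euv1].
have [w + [k Hk euv2]] := f22 _ _ Hu2 Hv2.
rewrite e1 => /lspan1[h ew]; rewrite {w}ew in euv2.
have Hm := f12 _ _ Hu1 Hv2; have Hn := f12 _ _ Hv1 Hu2.
have mult_a (lam : F) u : eigsp mul lam a u ->
    (a ** u = lam *: u) * (u ** a = lam *: u).
  by move=> Hu; rewrite [u ** a]mulC.
have multE := (aa, mult_a _ _ Hu1, mult_a _ _ Hu2, mult_a _ _ Hv1,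
  mult_a _ _ Hv2, mult_a _ _ Hk, mult_a _ _ Hm, mult_a _ _ Hn,
  euv1, euv2, mulC v1 u1, mulC v2 u2, mulC v2 u1, mulC u2 v1).
exists e, h.
have -> : P a (y ** z) = P a y * P a z + e + h.
  apply: (phi_unique pa); move: (P a y) (P a z) ey ez => p q -> ->.
  exists ((eta * p) *: v1 + (eta * q) *: u1 + k).
    by rewrite /eigsp /= !(mulE, multE); match_coefs; field.
  exists ((p / 2) *: v2 + (q / 2) *: u2 + u1 ** v2 + v1 ** u2).
    by rewrite /eigsp /= !(mulE, multE); match_coefs; field.
  by rewrite !(mulE, multE); match_coefs; field.
move: (P a y) (P a z) ey ez => p q -> ->.
split=> //.
(* Each of [k], [u1 ** v2], [v1 ** u2] gets the weights [eta], 1/2, 1/2 in some order from the three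
   terms on the left, so [(1 + eta) yz] accounts for it exactly. *)
- by rewrite !(mulE, multE); match_coefs; field.
(* Since [2az - z] has no 1/2-part, [u2 ** v2] does not enter; the multiples of [y], [z] and [a]
   remove the remaining eta-part and multiple of [a]. *)
- by rewrite /eigsp /= !(mulE, multE); match_coefs; field.
(* The two factors are [(1 - 2 * eta) *: u1] and [(1 - 2 * eta) *: v1]. *)
- by rewrite !(mulE, multE); match_coefs; field.
Qed.

(** * Projections and multiplication for a single axis *)

Lemma direct_zero a k u v : axisp a -> eigsp mul eta a u -> eigsp mul 2^-1 a v ->
  k *: a + u + v = 0 -> [/\ k = 0, u = 0 & v = 0].
Proof.
move=> [[_ [_ dir] _] a0 e1] Hu Hv E.
have Ha : eigsp mul 1 a (k *: a) by rewrite e1; exists (fun=> k); rewrite big_ord1.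
have [/eqP ka -> ->] := dir _ _ _ Ha Hu Hv E.
by move: ka; rewrite scaler_eq0 (negPf a0) orbF => /eqP ->.
Qed.

Lemma phi_lin a k y z : axisp a -> P a (k *: y + z) = k * P a y + P a z.
Proof.
move=> pa; apply: (phi_unique pa).
have [u1 Hu1 [u2 Hu2 ey]] := phiP y pa; have [v1 Hv1 [v2 Hv2 ez]] := phiP z pa.
move: (P a y) (P a z) ey ez => p q -> ->.
exists (k *: u1 + v1).
  by rewrite /eigsp /= !mulE Hu1 Hv1; match_coefs; ring.
exists (k *: u2 + v2); first by rewrite /eigsp /= !mulE Hu2 Hv2; match_coefs; ring.
by match_coefs; ring.
Qed.

Lemma phi_id a : axisp a -> P a a = 1.
Proof.
move=> pa; apply: (phi_unique pa); exists 0; first by rewrite /eigsp /= linear0r scaler0.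
exists 0; first by rewrite /eigsp /= linear0r scaler0.
by rewrite scale1r !addr0.
Qed.

Lemma phi_eta a u : axisp a -> eigsp mul eta a u -> P a u = 0.
Proof.
move=> pa Hu; apply: (phi_unique pa); exists u => //; exists 0.
  by rewrite /eigsp /= linear0r scaler0.
by rewrite scale0r add0r addr0.
Qed.

Lemma phi_half a u : axisp a -> eigsp mul 2^-1 a u -> P a u = 0.
Proof.
move=> pa Hu; apply: (phi_unique pa); exists 0.
  by rewrite /eigsp /= linear0r scaler0.
by exists u => //; rewrite scale0r !add0r.
Qed.

(** With [L] the multiplication by [a], the operator [(L - eta)(L - 1/2)] kills the eta- and
    1/2-parts of [y] and acts on [a] as [(1 - eta) / 2]. *)
Lemma mul_axis_twice a y : axisp a ->
  a ** (a ** y) = (eta + 2^-1) *: a ** y - (eta / 2) *: y + ((1 - eta) / 2 * P a y) *: a.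
Proof.
move=> pa; have [u1 Hu1 [u2 Hu2 ey]] := phiP y pa; have [[aa _ _] _ _] := pa.
move: (P a y) ey => p ->.
by rewrite !(mulE, aa, Hu1, Hu2); match_coefs; field.
Qed.

(** * Pairs of axes *)

Lemma axis_scale a b k : axisp a -> axisp b -> b = k *: a -> b = a.
Proof.
move=> [[aa _ _] a0 _] [[bb _ _] b0 _] bk.
move: bb; rewrite {1 2}bk mulZl mulZr aa {1}bk => /eqP.
rewrite -subr_eq0 -scalerBr scaler_eq0; case/orP => [/eqP k0|].
  by move: b0; rewrite bk k0 scale0r eqxx.
by rewrite subr_eq0 bk => /eqP.
Qed.

Lemma axes_free a b p q : axisp a -> axisp b -> a <> b ->
  p *: a + q *: b = 0 -> p = 0 /\ q = 0.
Proof.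
move=> pa pb ab E; have [q0|q0] := eqVneq q 0.
  move: E; rewrite q0 scale0r addr0 => /eqP; rewrite scaler_eq0.
  by case: pa => _ /negPf -> _; rewrite orbF => /eqP.
case: ab; apply/esym/(axis_scale (k := - (p / q)) pa pb).
apply: (scalerI q0); apply/eqP; rewrite -subr_eq0 -E; apply/eqP.
by match_coefs; field.
Qed.

(** Write [b = f a + u + v]. The hypothesis forces [(eta - q) u = 0] and [(1/2 - q) v = 0], so
    exactly one of [u], [v] survives. Comparing its coefficient in [bb = b] gives [f = 1] if it is
    [v] and [2 f eta = 1] if it is [u]. *)
Lemma coplanar_axes a b p q : axisp a -> axisp b -> a <> b ->
  a ** b = p *: a + q *: b ->
  [/\ q = 2^-1, P a b = 1 & p = 2^-1] \/ (q = eta /\ 2 * eta * p = 1 - eta).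
Proof.
move=> pa pb ab E; have [u Hu [v Hv]] := phiP b pa.
move: (P a b) => f eb.
have [[aa _ [_ [f11 _ f22]]] _ e1] := pa; have [[bb _ _] _ _] := pb.
have HZ lam k w : eigsp mul lam a w -> eigsp mul lam a (k *: w).
  by rewrite /eigsp /= mulZr => ->; rewrite !scalerA mulrC.
have Eab : (f - p - q * f) *: a + (eta - q) *: u + (2^-1 - q) *: v = 0.
  by apply: (eq_sub0 E); rewrite eb !(mulE, aa, Hu, Hv); match_coefs; ring.
have [/eqP + /eqP qu /eqP qv] := direct_zero pa (HZ _ _ _ Hu) (HZ _ _ _ Hv) Eab.
rewrite -addrA -opprD subr_eq0 => /eqP ep.
have ep' : p = f - q * f by rewrite {1}ep; ring.
move: qu qv; rewrite !scaler_eq0 !subr_eq0.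
have [u0 _|u0] := eqVneq u 0.
  have v0 : v != 0.
    apply/eqP => v0; apply: ab; apply/esym/(axis_scale (k := f) pa pb).
    by rewrite eb u0 v0 !addr0.
  rewrite (negPf v0) orbF => /eqP eq; left.
  have [w + [k Hk evv]] := f22 _ _ Hv Hv.
  rewrite e1 => /lspan1[h ew]; rewrite {w}ew in evv.
  have Ebb : (f ^+ 2 + h - f) *: a + k + (f - 1) *: v = 0.
    apply: (eq_sub0 bb).
    by rewrite eb u0 addr0 !(mulE, aa, Hv, mulC v a, evv); match_coefs; field.
  have [_ _ /eqP] := direct_zero pa Hk (HZ _ _ _ Hv) Ebb.
  rewrite scaler_eq0 (negPf v0) orbF subr_eq0 => /eqP e.
  by split=> //; rewrite ep' e -eq; field.
rewrite orbF => /eqP eq; rewrite -eq eq_sym (negPf eta_neq_half) /= => /eqP v0.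
right; split=> //; rewrite v0 addr0 in eb.
have := f11 _ _ Hu Hu; rewrite e1 => /lspan1[h euu].
have Ebb : (f ^+ 2 + h - f) *: a + (2 * f * eta - 1) *: u + 0 = 0.
  apply: (eq_sub0 bb).
  by rewrite eb !(mulE, aa, Hu, mulC u a, euu); match_coefs; ring.
have H0 : eigsp mul 2^-1 a 0 by rewrite /eigsp /= linear0r scaler0.
have [_ /eqP + _] := direct_zero pa (HZ _ _ _ Hu) H0 Ebb.
rewrite scaler_eq0 (negPf u0) orbF subr_eq0 => /eqP e.
have -> : 2 * eta * p = 2 * f * eta * (1 - eta) by rewrite ep' -eq; ring.
by rewrite e mul1r.
Qed.

(** In the second case of [coplanar_axes], the same lemma with [a] and [b] exchanged makes [p] equal
    to 1/2 or [eta], hence [eta = 1/2] or [(1 - 2 eta)(eta + 1) = 0]. *)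
Lemma coplanar_axes_mul a b p q : eta != -1 -> axisp a -> axisp b -> a <> b ->
  a ** b = p *: a + q *: b -> P a b = 1 /\ 2 *: a ** b = a + b.
Proof.
move=> eN pa pb ab E; have [[q2 -> p2]|[qe ep]] := coplanar_axes pa pb ab E.
  by rewrite E q2 p2; split=> //; match_coefs; field.
have E' : b ** a = q *: b + p *: a by rewrite mulC E addrC.
have [[p2 _ _]|[pe _]] := coplanar_axes pb pa (not_eq_sym ab) E'.
  case/eqP: half_neq; move: ep; rewrite p2 => /eqP; rewrite -subr_eq0 => /eqP ep.
  by apply: oppr_inj; rewrite oppr0 -ep; field.
move: ep; rewrite pe => /eqP; rewrite -subr_eq0.
have -> : 2 * eta * eta - (1 - eta) = - ((1 - 2 * eta) * (eta - (-1))) by ring.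
by rewrite oppr_eq0 mulf_eq0 (negPf half_neq) subr_eq0 (negPf eN).
Qed.

(** The cyclic identity with [y = z = b], where [bb = b] and [b(ba)] is reduced by [mul_axis_twice]
    for the axis [b]. *)
Lemma two_axes_relation a b : axisp a -> axisp b -> exists t,
  (2 * (1 + eta) * (1 - P a b)) *: a ** b
  + (P b a * (1 - eta) - (1 + eta) + 2 * eta * P a b) *: b + t *: a = 0.
Proof.
move=> pa pb; have [e [h [_ J _ _]]] := axis_products b b pa.
have [[bb _ _] _ _] := pb; rewrite bb [a ** b]mulC mul_axis_twice // in J.
exists (- eta - (- eta * P a b * P a b + eta * e + (1 - eta) * h)).
by apply: (eq_sub0 J); rewrite (mulC b a); match_coefs; field.
Qed.

(** At [eta = -1] the term in [ab] drops out of [two_axes_relation], and the coefficient of [b]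
    becomes twice the difference of the projections. *)
Lemma phi_sym a b : eta = -1 -> axisp a -> axisp b -> P a b = P b a.
Proof.
move=> eN pa pb; have [->|/eqP ab] := eqVneq a b; first by [].
have [t] := two_axes_relation pa pb; rewrite eN subrr mulr0 mul0r scale0r add0r.
rewrite addrC => /(axes_free pa pb ab)[_ E].
apply/esym; apply: (mulfI two_neq0); apply/eqP; rewrite -subr_eq0 -E; apply/eqP.
by ring.
Qed.

(** If the projection were not 1, [two_axes_relation] would put [ab] in the plane of [a] and [b],
    where [coplanar_axes_mul] makes it 1. *)
Lemma phi_eq1 a b : eta != -1 -> axisp a -> axisp b -> P a b = 1.
Proof.
move=> eN pa pb; have [->|/eqP ab] := eqVneq a b; first exact: phi_id.
have [t E] := two_axes_relation pa pb.
apply/eqP; apply: contraT => ne.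
set k := 2 * (1 + eta) * (1 - P a b) in E.
have k0 : k != 0.
  have e1 : 1 + eta != 0 by rewrite addrC addr_eq0.
  have p1 : 1 - P a b != 0 by rewrite subr_eq0 eq_sym.
  by rewrite !mulf_neq0.
move: E; set q := (X in _ + X *: b + _) => E.
have /(coplanar_axes_mul eN pa pb ab)[/eqP] : a ** b = (- t / k) *: a + (- q / k) *: b.
  apply: (scalerI k0); apply/eqP; rewrite -subr_eq0; apply/eqP.
  by apply: (eq_sub0 E); match_coefs; field.
by rewrite (negPf ne).
Qed.

(** * Triples of axes *)

Lemma phi_mul_axis a y : axisp a -> P a (a ** y) = P a y.
Proof.
move=> pa; apply: (phi_unique pa); have [[aa _ _] _ _] := pa.
have [u Hu [v Hv ey]] := phiP y pa; move: (P a y) ey => p ->.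
exists (eta *: u); first by rewrite /eigsp /= mulZr Hu.
exists (2^-1 *: v); first by rewrite /eigsp /= mulZr Hv.
by rewrite !mulE aa Hu Hv.
Qed.

Lemma three_axes_relation a b c e h : axisp a -> axisp b -> axisp c ->
  P a (b ** c) = P a b * P a c + e + h ->
  a ** (b ** c) + b ** (a ** c) + c ** (a ** b) =
    (1 + eta) *: (b ** c + P a b *: a ** c + P a c *: a ** b)
    - eta *: (P a b *: c + P a c *: b)
    + (- eta * P a b * P a c + eta * e + (1 - eta) * h) *: a ->
  (P a b *: a + b - 2 *: a ** b) ** (P a c *: a + c - 2 *: a ** c) =
    ((1 - 2 * eta) ^+ 2 * e) *: a ->
  (2 * eta ^+ 2 - 1) * P a b * P a c - (2 * eta - 1) * e =
    (2 * eta ^+ 2 - 1) * (2 * P a (b ** c) - P b c).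
Proof.
move=> pa pb pc Epsi Ja Ee; have [[aa _ _] a0 _] := pa.
(* Then the eta-part of [b] vanishes, and [e] comes from a product with it. *)
have e0 : P a b = 1 -> 2 *: a ** b = a + b -> e = 0.
  move=> E1 E; move: Ee; rewrite E1 scale1r E subrr linear0l => /esym/eqP.
  rewrite scaler_eq0 (negPf a0) orbF mulf_eq0 expf_eq0 (negPf half_neq) /=.
  by move/eqP.
(* The case [a = b] is separate because coefficients of [a] and [b] are compared below. *)
have [eab|/eqP ab] := eqVneq a b.
  rewrite e0 -eab ?phi_mul_axis ?phi_id ?aa //; first by ring.
  by match_coefs; ring.
have cyc d : a ** (b ** d) + b ** (a ** d) + d ** (a ** b) =
    b ** (a ** d) + a ** (b ** d) + d ** (b ** a).
  by rewrite (mulC a b) [X in X + _]addrC.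
(* For [eta = -1], the identities for the axes [a] and [b] have equal left sides, and all terms but
   multiples of [a] and [b] cancel on the right. *)
have [eN|eN] := eqVneq eta (-1).
  have [e' [h' [_ Jb _ _]]] := axis_products a c pb.
  have eq_coefs : (- eta * P a b * P a c + eta * e + (1 - eta) * h - P b c) *: a
      + (P a c - (- eta * P b a * P b c + eta * e' + (1 - eta) * h')) *: b = 0.
    have E := etrans (esym Ja) (etrans (cyc c) Jb).
    apply: (eq_sub0 E); rewrite (mulC b a) (phi_sym eN pb pa) eN.
    by match_coefs; ring.
  have [/eqP + _] := axes_free pa pb ab eq_coefs.
  rewrite subr_eq0 => /eqP <-; rewrite Epsi eN; ring.
have P1 := (phi_eq1 eN pa pb, phi_eq1 eN pb pa, phi_eq1 eN pa pc, phi_eq1 eN pb pc).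
rewrite !P1 in Epsi Ja *.
have eq0 : eta * e + (1 - eta) * h = 0.
  have [e' [h' [_ Jb _ _]]] := axis_products a c pb.
  rewrite !P1 in Jb.
  have eq_coefs : (eta * e + (1 - eta) * h) *: a
      + - (eta * e' + (1 - eta) * h') *: b = 0.
    have E := etrans (esym Ja) (etrans (cyc c) Jb).
    by apply: (eq_sub0 E); rewrite (mulC b a); match_coefs; ring.
  by have [] := axes_free pa pb ab eq_coefs.
(* The comparison is repeated with [bc] in place of [c]. If [psi] were not 1, it would put [ab] in
   the plane of [a] and [b]; then [e0] and [eq0] give [e = h = 0], so [psi = 1] after all. *)
have psi1 : P a (b ** c) = 1.
  have [e1 [h1 [_ J1 _ _]]] := axis_products b (b ** c) pa.
  have [e2 [h2 [_ J2 _ _]]] := axis_products a (b ** c) pb.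
  rewrite !P1 in J1; rewrite phi_mul_axis // !P1 in J2.
  have {J1 J2} [p [q E]] : exists p q,
      ((1 + eta) * (P a (b ** c) - 1)) *: a ** b = p *: a + q *: b.
    exists (eta * P a (b ** c) - eta * e1 - (1 - eta) * h1 - eta).
    exists (- eta + eta * e2 + (1 - eta) * h2 + eta * P a (b ** c)).
    have E := etrans (esym J1) (etrans (cyc (b ** c)) J2).
    apply: subr0_eq; apply: (eq_sub0 E); rewrite (mulC b a).
    by match_coefs; ring.
  apply/eqP/contraT => ne.
  have k0 : (1 + eta) * (P a (b ** c) - 1) != 0.
    by rewrite mulf_neq0 ?subr_eq0 // addrC addr_eq0.
  move: E; set k := _ * _ in k0 * => E.
  have /(coplanar_axes_mul eN pa pb ab)[_ E'] : a ** b = (p / k) *: a + (q / k) *: b.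
    apply: (scalerI k0); rewrite E; match_coefs; field => //.
  have {}e0 : e = 0 by apply: e0; rewrite ?P1.
  move/eqP: eq0; rewrite e0 mulr0 add0r mulf_eq0 subr_eq0 eq_sym (negPf eta_neq1).
  move=> /= /eqP h0; move: ne; by rewrite Epsi e0 h0 mulr1 !addr0 eqxx.
have h_e : h = - e.
  apply/eqP; rewrite -addr_eq0 addrC; apply/eqP/(addrI 1).
  by rewrite addr0 -[RHS]psi1 Epsi mulr1 addrA.
have : (1 - 2 * eta) * e = 0.
  by apply: oppr_inj; rewrite oppr0 -eq0 h_e; ring.
move/eqP; rewrite mulf_eq0 (negPf half_neq) /= => /eqP ->.
by rewrite psi1; ring.
Qed.

Lemma phi_comm a b : axisp a -> axisp b -> P a b = P b a.
Proof.
move=> pa pb; have [eN|eN] := eqVneq eta (-1); first exact: phi_sym.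
by rewrite !phi_eq1.
Qed.

Lemma half_vector a b c : axisp a -> axisp b -> axisp c ->
  eigsp mul 2^-1 a
    (((2 * eta ^+ 2 - 1) * (2 * P a (b ** c) - P b c)) *: a
     - (eta * P c a) *: b + ((eta - 2 * eta ^+ 2) * P a b) *: c
     - b ** c + 2 *: b ** (a ** c)).
Proof.
move=> pa pb pc; have [e [h [Epsi Ja W Ee]]] := axis_products b c pa.
rewrite -(three_axes_relation pa pb pc Epsi Ja Ee) -(phi_comm pa pc).
by congr (eigsp mul 2^-1 a _): W; match_coefs; ring.
Qed.

Lemma eigsp_subspace lam a : is_subspace (eigsp mul lam a).
Proof.
split=> [|k u v Hu Hv]; first by rewrite /eigsp /= linear0r scaler0.
by rewrite /eigsp /= !mulE Hu Hv; match_coefs; ring.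
Qed.

(** * The span of the eight products is a subalgebra *)

Section ClosedUnderAxis.
Variables (S : set A) (x y z : A).
Hypotheses (px : axisp x) (HS : is_subspace S).
Hypotheses (Sx : S x) (Sy : S y) (Sz : S z) (Sxy : S (x ** y)) (Sxz : S (x ** z)).
Hypotheses (Syz : S (y ** z)) (Sxyz : S (x ** (y ** z))).

Let SB u v : S u -> S v -> S (u - v).
Proof. by move=> Su Sv; apply: subspaceD => //; apply: subspaceN. Qed.

Let SD u v : S u -> S v -> S (u + v).
Proof. exact: subspaceD. Qed.

Let SZ k u : S u -> S (k *: u).
Proof. exact: subspaceZ. Qed.

Lemma mul_axis_twice_in : S (x ** (x ** y)).
Proof. by rewrite mul_axis_twice //; apply: SD; [apply: SB|]; apply: SZ. Qed.

Lemma third_product_in : S (y ** (x ** z)) -> S (z ** (x ** y)).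
Proof.
move=> Syxz; have [e [h [_ J _ _]]] := axis_products y z px.
move/eqP: J; rewrite addrC eq_sym -subr_eq eq_sym => /eqP ->.
by do !(apply: SB || apply: SD || apply: SZ).
Qed.

(** Multiplication by [x] halves the 1/2-eigenvector [2 y(xz) - yz + ...] of [axis_products]; the
    resulting equation is solved for [x(y(xz))]. *)
Lemma mul_axis_product_in : S (y ** (x ** z)) -> S (x ** (y ** (x ** z))).
Proof.
move=> Syxz; have [e [h [_ _ W _]]] := axis_products y z px.
have [[xx _ _] _ _] := px.
set w := _ - _ *: z in W; set k := (X in X *: x) in W.
have -> : x ** (y ** (x ** z)) = 2^-1 *: (2^-1 *: (w + k *: x) + x ** (y ** z)
    + (eta * P x z) *: x ** y + ((2 * eta ^+ 2 - eta) * P x y) *: x ** z - k *: x).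
  by rewrite -W /w !(mulE, xx); match_coefs; field.
rewrite /w; by do !(apply: SB || apply: SD || apply: SZ).
Qed.

End ClosedUnderAxis.

Lemma span_is_subalgebra a b c : axisp a -> axisp b -> axisp c ->
  is_subalgebra mul (lspan [:: a; b; c; a ** b; b ** c; a ** c;
                               a ** (b ** c); b ** (a ** c)]).
Proof.
move=> pa pb pc; set gens := [:: a; _; _; _; _; _; _; _].
set S := lspan gens; have HS : is_subspace S by exact: lspan_subspace.
have gen v : v \in gens -> S v by exact: lspan_mem.
have Sa : S a by apply: gen; rewrite !inE eqxx ?orbT.
have Sb : S b by apply: gen; rewrite !inE eqxx ?orbT.
have Sc : S c by apply: gen; rewrite !inE eqxx ?orbT.
have Sab : S (a ** b) by apply: gen; rewrite !inE eqxx ?orbT.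
have Sbc : S (b ** c) by apply: gen; rewrite !inE eqxx ?orbT.
have Sac : S (a ** c) by apply: gen; rewrite !inE eqxx ?orbT.
have Sabc : S (a ** (b ** c)) by apply: gen; rewrite !inE eqxx ?orbT.
have Sbac : S (b ** (a ** c)) by apply: gen; rewrite !inE eqxx ?orbT.
have Scab : S (c ** (a ** b)) by exact: (third_product_in (y := b)).
have [[aa _ _] _ _] := pa; have [[bb _ _] _ _] := pb; have [[cc _ _] _ _] := pc.
(* Stability of [S] under an axis thus needs checking on the eight generators only. *)
have preim x : is_subspace [set v | S (x ** v)].
  split=> [|k u v Su Sv] /=; first by rewrite linear0r; case: HS.
  by rewrite !mulE; apply: subspaceD => //; apply: subspaceZ.
have sub_preim x : S (x ** a) -> S (x ** b) -> S (x ** c) -> S (x ** (a ** b)) ->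
    S (x ** (b ** c)) -> S (x ** (a ** c)) -> S (x ** (a ** (b ** c))) ->
    S (x ** (b ** (a ** c))) -> forall u, S u -> S (x ** u).
  move=> *; have: S `<=` [set v | S (x ** v)]; last exact.
  by do !(apply: lspan_cons_sub => //); apply: lspan_nil_sub.
(* Each product of the axis with a generator is known to lie in [S] or has the form [x(xy)] or
   [x(y(xz))]; likewise for [b] and [c] after commuting factors. *)
have ad_a u : S u -> S (a ** u).
  apply: sub_preim; rewrite ?aa //; by [exact: mul_axis_twice_in |
    exact: mul_axis_product_in].
have ad_b u : S u -> S (b ** u).
  have Sba : S (b ** a) by rewrite mulC.
  have Sacb : S (a ** (b ** c)) by [].
  apply: sub_preim; rewrite ?bb ?(mulC a b) //; by [exact: mul_axis_twice_in |
    exact: mul_axis_product_in].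
have ad_c u : S u -> S (c ** u).
  have Sca : S (c ** a) by rewrite mulC.
  have Scb : S (c ** b) by rewrite mulC.
  have Sba : S (b ** a) by rewrite mulC.
  have Scba : S (c ** (b ** a)) by rewrite (mulC b a).
  have Sacb : S (a ** (c ** b)) by rewrite (mulC c b).
  have Sbca : S (b ** (c ** a)) by rewrite (mulC c a).
  apply: sub_preim; rewrite ?cc ?(mulC b c) ?(mulC a c) //;
    by [exact: mul_axis_twice_in | exact: mul_axis_product_in].
split=> // u v Su; move: v.
(* The set of multipliers of S: the cyclic identity of [axis_products] makes it
   stable under multiplication by the generating axes. *)
pose N := [set v | S v /\ forall u, S u -> S (u ** v)].
have HN : is_subspace N.
  split=> [|k v w [Sv Nv] [Sw Nw]].
    by split=> [|w _]; rewrite ?linear0r; case: HS.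
  split=> [|t St]; first by apply: subspaceD => //; apply: subspaceZ.
  by rewrite !mulE; apply: subspaceD; [|apply: subspaceZ; [|exact: Nv]|exact: Nw].
have NM x y : axisp x -> S x -> (forall u, S u -> S (x ** u)) -> N y -> N (x ** y).
  move=> px Sx ad_x [Sy Ny]; split=> [|z Sz]; first exact: ad_x.
  have [Sxy Sxz] := (ad_x _ Sy, ad_x _ Sz).
  have Szy := Ny _ Sz; rewrite mulC in Szy.
  have Sxyz := ad_x _ Szy; have := Ny _ Sxz; rewrite mulC => Syxz.
  exact: (third_product_in (y := y)).
have NG x : S x -> (forall u, S u -> S (x ** u)) -> N x.
  by move=> Sx ad_x; split=> // w Sw; rewrite mulC; apply: ad_x.
have Na := NG _ Sa ad_a; have Nb := NG _ Sb ad_b; have Nc := NG _ Sc ad_c.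
have NMa y := NM a y pa Sa ad_a; have NMb y := NM b y pb Sb ad_b.
have Nab := NMa _ Nb; have Nbc := NMb _ Nc; have Nac := NMa _ Nc.
have Nabc := NMa _ Nbc; have Nbac := NMb _ Nac.
have SN : S `<=` N.
  exact: (lspan_cons_sub HN Na (lspan_cons_sub HN Nb (lspan_cons_sub HN Nc
    (lspan_cons_sub HN Nab (lspan_cons_sub HN Nbc (lspan_cons_sub HN Nac
    (lspan_cons_sub HN Nabc (lspan_cons_sub HN Nbac (lspan_nil_sub HN))))))))).
by move=> v /SN[_]; apply.
Qed.

(** * Spanning sets of the eigenspaces *)

(** For a primitive axis [a], [eta_part a] and [half_part a] are the projections on the eta- and
    1/2-eigenspaces, scaled by the nonzero factors [1 - 2 * eta] and [2^-1 - eta]. *)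
Let eta_part a y := P a y *: a + y - 2 *: a ** y.
Let half_part a y := (P a y * (eta - 1)) *: a - eta *: y + a ** y.

Lemma eta_part_eigsp a y : axisp a -> eigsp mul eta a (eta_part a y).
Proof.
move=> pa; have [[aa _ _] _ _] := pa.
rewrite /eigsp /eta_part /= !(mulE, aa) mul_axis_twice //.
by match_coefs; field.
Qed.

Lemma half_part_eigsp a y : axisp a -> eigsp mul 2^-1 a (half_part a y).
Proof.
move=> pa; have [[aa _ _] _ _] := pa.
rewrite /eigsp /half_part /= !(mulE, aa) mul_axis_twice //.
by match_coefs; field.
Qed.

Lemma eta_part_subspace a S : axisp a -> is_subspace S ->
  is_subspace [set y | S (eta_part a y)].
Proof.
move=> pa HS; have lin k u v : eta_part a (k *: u + v) = k *: eta_part a u + eta_part a v.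
  by rewrite /eta_part phi_lin // !mulE; match_coefs; ring.
have e0 : eta_part a 0 = 0.
  by have := lin (-1) 0 0; rewrite scaler0 addr0 scaleN1r addNr.
by split=> [|k u v Su Sv] /=; rewrite ?e0 ?lin; case: HS => // _; apply.
Qed.

Lemma half_part_subspace a S : axisp a -> is_subspace S ->
  is_subspace [set y | S (half_part a y)].
Proof.
move=> pa HS.
have lin k u v : half_part a (k *: u + v) = k *: half_part a u + half_part a v.
  by rewrite /half_part phi_lin // !mulE; match_coefs; ring.
have e0 : half_part a 0 = 0.
  by have := lin (-1) 0 0; rewrite scaler0 addr0 scaleN1r addNr.
by split=> [|k u v Su Sv] /=; rewrite ?e0 ?lin; case: HS => // _; apply.
Qed.

Lemma eta_part_axis a : axisp a -> eta_part a a = 0.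
Proof.
move=> pa; have [[aa _ _] _ _] := pa.
by rewrite /eta_part phi_id // aa; match_coefs; ring.
Qed.

Lemma half_part_axis a : axisp a -> half_part a a = 0.
Proof.
move=> pa; have [[aa _ _] _ _] := pa.
by rewrite /half_part phi_id // aa; match_coefs; ring.
Qed.

Lemma eta_part_mul a y : axisp a -> eta_part a (a ** y) = eta *: eta_part a y.
Proof.
move=> pa; rewrite /eta_part phi_mul_axis // mul_axis_twice //.
by match_coefs; field.
Qed.

Lemma half_part_mul a y : axisp a -> half_part a (a ** y) = 2^-1 *: half_part a y.
Proof.
move=> pa; rewrite /half_part phi_mul_axis // mul_axis_twice //.
by match_coefs; field.
Qed.

Lemma eta_part_eta a u : axisp a -> eigsp mul eta a u ->
  eta_part a u = (1 - 2 * eta) *: u.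
Proof.
by move=> pa Hu; rewrite /eta_part phi_eta // Hu; match_coefs; ring.
Qed.

Lemma eta_part_half a u : axisp a -> eigsp mul 2^-1 a u -> eta_part a u = 0.
Proof.
by move=> pa Hu; rewrite /eta_part phi_half // Hu; match_coefs; field.
Qed.

Lemma half_part_half a u : axisp a -> eigsp mul 2^-1 a u ->
  half_part a u = (2^-1 - eta) *: u.
Proof.
by move=> pa Hu; rewrite /half_part phi_half // Hu; match_coefs; field.
Qed.

Section Eigenspaces.
Variables a b c : A.
Hypotheses (pa : axisp a) (pb : axisp b) (pc : axisp c).
Hypothesis spanA : [set: A] =
  lspan [:: a; b; c; a ** b; b ** c; a ** c; a ** (b ** c); b ** (a ** c)].

Let w := ((2 * eta ^+ 2 - 1) * (2 * P a (b ** c) - P b c)) *: a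
     - (eta * P c a) *: b + ((eta - 2 * eta ^+ 2) * P a b) *: c
     - b ** c + 2 *: b ** (a ** c).

(** The generator [b(ac)] is traded for the 1/2-eigenvector [w], in which it has the invertible
    coefficient 2. *)
Let full_subspace S : is_subspace S -> S a -> S b -> S c -> S (a ** b) ->
  S (b ** c) -> S (a ** c) -> S (a ** (b ** c)) -> S w -> forall v, S v.
Proof.
move=> HS Sa Sb Sc Sab Sbc Sac Sabc Sw v.
have Sbac : S (b ** (a ** c)).
  have -> : b ** (a ** c) = 2^-1 *: (w
      - ((2 * eta ^+ 2 - 1) * (2 * P a (b ** c) - P b c)) *: a
      + (eta * P c a) *: b - ((eta - 2 * eta ^+ 2) * P a b) *: c + b ** c).
    by rewrite /w; match_coefs; field.
  apply: subspaceZ => //; do ![apply: subspaceD => //];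
    by do ?[apply: subspaceN => //]; apply: subspaceZ.
have : [set: A] v by [].
rewrite spanA; move: v.
exact: (lspan_cons_sub HS Sa (lspan_cons_sub HS Sb (lspan_cons_sub HS Sc
    (lspan_cons_sub HS Sab (lspan_cons_sub HS Sbc (lspan_cons_sub HS Sac
    (lspan_cons_sub HS Sabc (lspan_cons_sub HS Sbac (lspan_nil_sub HS))))))))).
Qed.

(** The eigenspace is the image of [eta_part a], which kills [a] and [w] and sends [ay] to [eta]
    times the image of [y]; only [b], [c] and [bc] contribute. *)
Lemma eigsp_eta_span :
  eigsp mul eta a =
    lspan [:: eta_part a b; eta_part a c; eta_part a (b ** c)].
Proof.
set s := [:: _; _; _]; have HS := lspan_subspace s.
have Sb : lspan s (eta_part a b) by apply: lspan_mem; rewrite !inE eqxx.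
have Sc : lspan s (eta_part a c) by apply: lspan_mem; rewrite !inE eqxx orbT.
have Sbc : lspan s (eta_part a (b ** c)) by apply: lspan_mem; rewrite !inE eqxx !orbT.
apply/seteqP; split.
  move=> u Hu; rewrite -[u]scale1r -(mulVf half_neq) -scalerA -(eta_part_eta pa Hu).
  apply: subspaceZ => //; move: u {Hu}.
  apply: full_subspace; rewrite /= ?eta_part_axis ?eta_part_mul //.
  - exact: eta_part_subspace.
  - by case: HS.
  - exact: subspaceZ.
  - exact: subspaceZ.
  - exact: subspaceZ.
  by rewrite eta_part_half; [case: HS| |exact: half_vector].
have E y := eta_part_eigsp y pa; have HE := eigsp_subspace eta a.
exact: (lspan_cons_sub HE (E _) (lspan_cons_sub HE (E _)
  (lspan_cons_sub HE (E _) (lspan_nil_sub HE)))).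
Qed.

(** As for the eta-eigenspace, except that [half_part a] rescales [w] by a nonzero factor, which
    adds a fourth vector. *)
Lemma eigsp_half_span :
  eigsp mul 2^-1 a =
    lspan [:: half_part a b; half_part a c; half_part a (b ** c); w].
Proof.
set s := [:: _; _; _; _]; have HS := lspan_subspace s.
have Sb : lspan s (half_part a b) by apply: lspan_mem; rewrite !inE eqxx.
have Sc : lspan s (half_part a c) by apply: lspan_mem; rewrite !inE eqxx orbT.
have Sbc : lspan s (half_part a (b ** c)) by apply: lspan_mem; rewrite !inE eqxx !orbT.
have Sw : lspan s w by apply: lspan_mem; rewrite !inE eqxx !orbT.
have k0 : 2^-1 - eta != 0 by rewrite subr_eq0 eq_sym.
have Hw : eigsp mul 2^-1 a w by exact: half_vector.
apply/seteqP; split.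
  move=> u Hu; rewrite -[u]scale1r -(mulVf k0) -scalerA -(half_part_half pa Hu).
  apply: subspaceZ => //; move: u {Hu}.
  apply: full_subspace; rewrite /= ?half_part_axis ?half_part_mul //.
  - exact: half_part_subspace.
  - by case: HS.
  - exact: subspaceZ.
  - exact: subspaceZ.
  - exact: subspaceZ.
  by rewrite half_part_half //; apply: subspaceZ.
have E y := half_part_eigsp y pa; have HE := eigsp_subspace 2^-1 a.
exact: (lspan_cons_sub HE (E _) (lspan_cons_sub HE (E _)
  (lspan_cons_sub HE (E _) (lspan_cons_sub HE Hw (lspan_nil_sub HE))))).
Qed.

End Eigenspaces.
End PrimitiveAxes.

Theorem theorem1p2 (F : fieldType) (eta : F) (A : lmodType F)
    (mul : {bilinear A -> A -> A}) (a b c : A) :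
  2%N \notin [pchar F] -> eta != 2^-1 -> eta != 1 ->
  axial_algebra eta mul ->
  primitive_axis eta mul a ->
  primitive_axis eta mul b ->
  primitive_axis eta mul c ->
  generates mul [set a; b; c] ->
  let ab := mul a b in let bc := mul b c in let ac := mul a c in
  let a_bc := mul a bc in let b_ac := mul b ac in
  let alpha := phi eta mul a b in
  let beta := phi eta mul b c in
  let gamma := phi eta mul c a in
  let psi := phi eta mul a bc in
  [/\ [set: A] = lspan [:: a; b; c; ab; bc; ac; a_bc; b_ac],
      dim_le A 8,
      eigsp mul eta a =
        lspan [:: alpha *: a + b - 2 *: ab;
                  gamma *: a + c - 2 *: ac;
                  psi *: a + bc - 2 *: a_bc] &
      eigsp mul 2^-1 a =
        lspan [:: (alpha * (eta - 1)) *: a - eta *: b + ab;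
                  (gamma * (eta - 1)) *: a - eta *: c + ac;
                  (psi * (eta - 1)) *: a - eta *: bc + a_bc;
                  ((2 * eta ^+ 2 - 1) * (2 * psi - beta)) *: a
                    - (eta * gamma) *: b
                    + ((eta - 2 * eta ^+ 2) * alpha) *: c
                    - bc + 2 *: b_ac]].
Proof.
move=> char2 eta_half eta1 [mulC _] pa pb pc gen ab bc ac a_bc b_ac alpha beta gamma psi.
have two : 2 != 0 :> F by move: char2; rewrite inE /=.
have sub := span_is_subalgebra two mulC pa pb pc.
have spanA : [set: A] = lspan [:: a; b; c; ab; bc; ac; a_bc; b_ac].
  apply/esym/(gen _ sub) => v /=.
  by case=> [[->|->]|->]; apply: lspan_mem; rewrite !inE eqxx ?orbT.
split=> //.
- exact: (lspan_dim_le spanA).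
- rewrite (eigsp_eta_span two eta_half eta1 mulC pa pb pc spanA).
  (* The spanning vectors carry [phi_a(c)], whereas [gamma] is [phi_c(a)]. *)
  by rewrite /gamma -(phi_comm two eta_half mulC pa pc).
- rewrite (eigsp_half_span two eta_half eta1 mulC pa pb pc spanA).
  by rewrite /gamma -(phi_comm two eta_half mulC pa pc).
Qed.
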